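(* Let $T$ be a discrete semigroup with identity (or a discrete group), let $\mathcal I$ be an ideal on $T$, and let $X$ be a compact Hausdorff space with its unique compatible uniform structure $\mathcal K$. Let $\mathfrak X\in Act(T,X)$ be an action such that the transformation semigroup $(T,X,\mathfrak X)$ is $\mathcal I$-expansive and has the $\mathcal I$-shadowing property. Then $\mathfrak X$ is $\mathcal I$-topological stable.
   Context: A transformation semigroup $(T,X,\rho)$ consists of a topological space $X$, a discrete semigroup $T$ with identity $e$, and a continuous map $\rho:T\times X\to X$, $(t,x)\mapsto tx$, with $ex=x$ and $(ts)x=t(sx)$ for all $x\in X$, $s,t\in T$; it is a transformation group if $T$ is a group. Put $\rho^t(x)=tx$. $Act(T,X)$ is the set of all such actions $\rho$ of $T$ on $X$; an action $\mathfrak X\in Act(T,X)$ is identified with the family $(\mathfrak X^t)_{t\in T}\in F(X)^T$, where $F(X)$ is the set of all self-maps of $X$. An ideal $\mathcal I$ on $T$ is a nonempty collection of subsets of $T$ closed under finite unions and under taking subsets. For a uniform space $(X,\mathcal K)$ (with $X$ carrying the uniform topology), a family $(x_t)_{t\in T}$ in $X$, $\theta\in\mathcal K$ and a nonempty $A\subseteq T$: $(x_t)_{t\in T}$ is a $\theta$-pseudo orbit with respect to $A$ if $(ax_t,x_{at})\in\theta$ for all $a\in A$, $t\in T$; a point $x\in X$ is a $\theta$-trace of $(x_t)_{t\in T}$ if $(tx,x_t)\in\theta$ for all $t\in T$. $(T,X)$ has the shadowing property with respect to $A$ if for each $\alpha\in\mathcal K$ there is $\beta\in\mathcal K$ such that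 every $\beta$-pseudo orbit with respect to $A$ has an $\alpha$-trace. $(T,X)$ has the $\mathcal I$-shadowing property if there is a nonempty $A\in\mathcal I$ such that $(T,X)$ has the shadowing property with respect to $A$. $(T,X)$ is $\mathcal I$-expansive if there exists $\alpha\in\mathcal K$ such that for all distinct $x,y\in X$ and all $E\in\mathcal I$ there exists $t\in T\setminus E$ with $(tx,ty)\notin\alpha$. For $\theta\in\mathcal K$ let $B_\theta=\{(f,g)\in F(X)\times F(X):\forall x\in X\ (f(x),g(x))\in\theta\}$, and for $A\subseteq T$ let $\mathcal C(A,T,\theta)=\{((f_t)_{t\in T},(g_t)_{t\in T})\in F(X)^T\times F(X)^T:\forall t\in A\ (f_t,g_t)\in B_\theta\}$. Let $\mathfrak U_{\mathcal I}$ be the uniform structure on $F(X)^T$ consisting of all $\alpha\subseteq F(X)^T\times F(X)^T$ for which there are $\lambda\in\mathcal K$ and $B\in\mathcal I$ with $\mathcal C(B,T,\lambda)\subseteq\alpha$; $F(X)^T$ carries the induced uniform topology. $\mathfrak X\in Act(T,X)$ is $\mathcal I$-topological stable if for each $\theta\in\mathcal K$ there is an open neighbourhood $U$ of $\mathfrak X$ in $(F(X)^T,\mathfrak U_{\mathcal I})$ such that for each $\mathfrak Z\in U\cap Act(T,X)$ there is a homomorphism $f:(T,X,\mathfrak Z)\to(T,X,\mathfrak X)$, i.e. a continuous $f:X\to X$ with $f(\mathfrak Z^t x)=\mathfrak X^t f(x)$ for all $t\in T$, $x\in X$, such that $(f,\mathrm{id}_X)\in B_\theta$. *)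

(* Defs.v *)
From HB Require Import structures.
From mathcomp Require Import all_boot.
From mathcomp Require Import all_classical topology.

Set Implicit Arguments.
Unset Strict Implicit.
Unset Printing Implicit Defensive.

Local Open Scope classical_set_scope.

(* A transformation semigroup (T, X, rho) has a monoid T of times; a
   transformation group is the case where T is a groupType, which inherits from
   monoidType and brings no further requirement on rho. The type
   [discrete_topology T] is T with its discrete topology, so that continuity is
   that of rho on the product T x X. An action rho is identified with the
   family (rho t)_t. *)
Definition Act (T : monoidType) (X : topologicalType) : set (T -> X -> X) :=
  [set rho | [/\ continuous (fun p : discrete_topology T * X => rho p.1 p.2),
     (forall x, rho 1%g x = x) &
     (forall t s x, rho (t * s)%g x = rho t (rho s x))]].

(* The empty set is in every ideal, by [ideal_nonempty] and [ideal_subset], so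
   binary unions account for all finite ones. An ideal may contain [set: T]. *)
Record ideal (T : Type) := Ideal {
  ideal_sets :> set T -> Prop;
  ideal_nonempty : exists A, ideal_sets A;
  ideal_setU : forall A B, ideal_sets A -> ideal_sets B -> ideal_sets (A `|` B);
  ideal_subset : forall A B, A `<=` B -> ideal_sets B -> ideal_sets A
}.

Section Dynamics.
Context {T : monoidType} {X : uniformType}.
Implicit Types (theta : set (X * X)) (A : set T) (I : ideal T).
Implicit Types (rho : T -> X -> X) (x : X).

Definition is_pseudo_orbit rho theta A (xs : T -> X) :=
  forall a t, A a -> theta (rho a (xs t), xs (a * t)%g).

Definition is_trace rho theta (xs : T -> X) x :=
  forall t, theta (rho t x, xs t).

Definition shadowing rho A :=
  forall alpha, entourage alpha -> exists2 beta, entourage beta &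
    forall xs, is_pseudo_orbit rho beta A xs ->
      exists x, is_trace rho alpha xs x.

Definition ideal_shadowing I rho :=
  exists A, [/\ A !=set0, I A & shadowing rho A].

Definition ideal_expansive I rho :=
  exists2 alpha : set (X * X), entourage alpha &
    forall x y, x <> y -> forall E, I E ->
      exists2 t, (~` E) t & ~ alpha (rho t x, rho t y).

End Dynamics.

Definition close_maps {X : Type} (theta : set (X * X)) :
    set ((X -> X) * (X -> X)) :=
  [set fg | forall x, theta (fg.1 x, fg.2 x)].

Definition close_families {T X : Type} (A : set T) (theta : set (X * X)) :
    set ((T -> X -> X) * (T -> X -> X)) :=
  [set fg | forall t, A t -> close_maps theta (fg.1 t, fg.2 t)].

(* The set F(X)^T of all families of self-maps of X, as an alias that depends
   on I so that it can carry the uniform structure defined by I. *)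
Definition family_space {T : Type} (I : ideal T) (X : uniformType) : Type :=
  T -> X -> X.

Section FamilyUniform.
Context {T : Type} (I : ideal T) (X : uniformType).
Local Open Scope relation_scope.

Definition family_ent : set_system (family_space I X * family_space I X) :=
  [set alpha | exists lambda B,
     [/\ entourage lambda, I B & close_families B lambda `<=` alpha]].

Lemma family_ent_filter : Filter family_ent.
Proof.
split.
- have [B IB] := ideal_nonempty I.
  by exists setT, B; split => //; exact: filterT.
- move=> P Q [l [B [el IB lBP]]] [m [C [em IC mCQ]]].
  exists (l `&` m), (B `|` C); split; [exact: filterI|exact: ideal_setU|].
  move=> fg h; split.
    by apply: lBP => t Bt x; have [] := h t (or_introl Bt) x.
  by apply: mCQ => t Ct x; have [] := h t (or_intror Ct) x.
- move=> P Q PQ [l [B [el IB lBP]]]; exists l, B; split => //.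
  exact: subset_trans PQ.
Qed.

Lemma family_ent_diagonal A : family_ent A -> diagonal `<=` A.
Proof.
move=> [l [B [el _ lBA]]] [f g] /= fg; apply: lBA => t _ x /=.
by rewrite /diagonal /= in fg; rewrite fg; exact: entourage_refl.
Qed.

Lemma family_ent_inv A : family_ent A -> family_ent A^-1.
Proof.
move=> [l [B [el IB lBA]]]; exists l^-1, B.
by split => // fg h; apply: lBA.
Qed.

Lemma family_ent_split A :
  family_ent A -> exists2 B, family_ent B & B \; B `<=` A.
Proof.
move=> [l [B [el IB lBA]]]; exists (close_families B (split_ent l)).
  by exists (split_ent l), B; split => //; exact: entourage_split_ent.
move=> [f g] [h /= fh hg]; apply: lBA => t Bt x /=.
by apply: (entourage_split (h t x)) => //; [exact: fh|exact: hg].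
Qed.

HB.instance Definition _ := Choice.copy (family_space I X) (T -> X -> X).
HB.instance Definition _ := isUniform.Build (family_space I X)
  family_ent_filter family_ent_diagonal family_ent_inv family_ent_split.

End FamilyUniform.

Definition homomorphism {T : Type} {X Y : topologicalType}
    (sigma : T -> X -> X) (rho : T -> Y -> Y) (f : X -> Y) :=
  continuous f /\ forall t x, f (sigma t x) = rho t (f x).

Definition ideal_topological_stable {T : monoidType} {X : uniformType}
    (I : ideal T) (rho : T -> X -> X) :=
  forall theta : set (X * X), entourage theta ->
    exists U : set (family_space I X), [/\ open U, U rho &
      forall sigma, (U `&` @Act T X) sigma ->
        exists2 f : X -> X, homomorphism sigma rho f & close_maps theta (f, id)].

(* Main.v *)
(** For a nearby action [sigma], every orbit of [sigma] is a pseudo orbit of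
    [rho], so shadowing yields a point [f x] whose [rho]-orbit follows the
    [sigma]-orbit of [x]. Expansivity makes this point unique, hence [f]
    intertwines the actions: [f (sigma t x)] and [rho t (f x)] both trace the
    [sigma]-orbit of [sigma t x]. By the same token every cluster value of [f]
    at [x] follows the [sigma]-orbit of [x], so it is [f x], and compactness
    gives continuity. *)
Require Import Defs.
From mathcomp Require Import all_boot.
From mathcomp Require Import all_classical topology.

Local Open Scope classical_set_scope.

(** Compactness gives some cluster point of [F]; it can only be [l], so the cluster set is exactly
    [l]. *)
Lemma compact_cvg_unique_cluster (X : topologicalType) (F : set_system X)
    (l : X) : ProperFilter F -> hausdorff_space X -> compact [set: X] ->
  (forall y, cluster F y -> y = l) -> F --> l.
Proof.
move=> PF hX cX Fl; apply: (@compact_cluster_set1 _ _ _ setT) => //;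
  try exact: filterT.
apply/seteqP; split=> [y /Fl//|_ ->].
by have [y [_ /[dup] /Fl ->]] := cX F PF filterT.
Qed.

Lemma Act_continuous (T : monoidType) (X : topologicalType)
    (rho : T -> X -> X) (t : T) : @Act T X rho -> continuous (rho t).
Proof.
move=> [rho_cont _ _] x.
have -> : rho t = (fun p : discrete_topology T * X => rho p.1 p.2) \o
  (fun y => (t : discrete_topology T, y)) by [].
apply: continuous_comp; last exact: rho_cont.
exact: (cvg_pair (cvg_cst (t : discrete_topology T)) cvg_id).
Qed.

Lemma family_nbhs (T : Type) (I : ideal T) (X : uniformType)
    (rho : family_space I X) (A : set T) (theta : set (X * X)) :
  I A -> entourage theta ->
  exists U : set (family_space I X), [/\ open U, U rho &
    forall sigma, U sigma -> close_families A theta (rho, sigma)].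
Proof.
move=> IA etheta.
have : nbhs rho (xsection (close_families A theta) rho).
  by apply: nbhs_entourage; exists theta, A; split.
rewrite nbhsE => -[U [oU Urho] sU]; exists U; split=> // sigma /sU.
by move=> /xsectionP.
Qed.

Section TracingMap.
Context {T : monoidType} {X : uniformType}.
Variables (rho sigma : T -> X -> X) (alpha : set (X * X)).
Hypothesis ealpha : entourage alpha.
Hypothesis separated :
  forall x y, (forall t, alpha (rho t x, rho t y)) -> x = y.

(** At each time both orbits are close to [xs t]. Entourages are not symmetric, so the inverse is
    included to reverse the second trace. *)
Lemma trace_unique (xs : T -> X) (gamma : set (X * X)) (x y : X) :
  gamma `<=` split_ent alpha `&` (split_ent alpha)^-1%relation ->
  is_trace rho gamma xs x -> is_trace rho gamma xs y -> x = y.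
Proof.
move=> ga tx ty; apply: separated => t; apply: (entourage_split (xs t)) => //.
  exact: (ga _ (tx t)).1.
exact: (ga _ (ty t)).2.
Qed.

Lemma tracing_map_equivariant (gamma : set (X * X)) (f : X -> X) :
  (forall t s x, rho (t * s)%g x = rho t (rho s x)) ->
  (forall t s x, sigma (t * s)%g x = sigma t (sigma s x)) ->
  gamma `<=` split_ent alpha `&` (split_ent alpha)^-1%relation ->
  (forall x, is_trace rho gamma (sigma ^~ x) (f x)) ->
  forall t x, f (sigma t x) = rho t (f x).
Proof.
move=> rhoM sigmaM ga trf t x; apply: (trace_unique _ _ _ _ ga (trf _)) => s.
by rewrite -rhoM -sigmaM; exact: trf.
Qed.

Lemma tracing_map_continuous (gamma : set (X * X)) (f : X -> X) :
  compact [set: X] -> hausdorff_space X ->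
  (forall t, continuous (rho t)) -> (forall t, continuous (sigma t)) ->
  gamma `<=` split_ent (split_ent alpha) `&`
    (split_ent (split_ent alpha))^-1%relation ->
  (forall x, is_trace rho gamma (sigma ^~ x) (f x)) ->
  continuous f.
Proof.
move=> cX hX rho_cont sigma_cont ga trf x.
apply: compact_cvg_unique_cluster => // y fxy; apply: separated => t.
pose delta : set (X * X) := split_ent (split_ent alpha).
have edelta : entourage delta by do 2 apply: entourage_split_ent.
have nx : \forall x' \near x, delta (sigma t x', sigma t x).
  exact: (cvg_entourage (sigma_cont t x) (entourage_inv edelta)).
(* As [t] is fixed before [x'] is chosen, continuity of each single map suffices. *)
have ny : \forall y' \near y, delta (rho t y, rho t y').
  exact: (cvg_entourage (rho_cont t y) edelta).
have fnx : (f @ x) (f @` [set x' | delta (sigma t x', sigma t x)]).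
  by apply: filterS nx => x' x'x; exists x'.
have [_ [[x' x'x <-] yfx']] := fxy _ _ fnx ny.
(* Four [delta]-steps: [rho t y], [rho t (f x')], [sigma t x'], [sigma t x], [rho t (f x)]. *)
apply: (entourage_split (sigma t x')) => //.
  by apply: (entourage_split (rho t (f x'))) => //; exact: (ga _ (trf x' t)).1.
by apply: (entourage_split (sigma t x)) => //; exact: (ga _ (trf x t)).2.
Qed.

End TracingMap.

Theorem theorem34 (T : monoidType) (I : ideal T) (X : uniformType)
    (compactX : compact [set: X]) (hausdorffX : hausdorff_space X)
    (rho : T -> X -> X) (actrho : @Act T X rho)
    (expansive : ideal_expansive I rho) (shadow : ideal_shadowing I rho) :
  ideal_topological_stable I rho.
Proof.
move=> theta etheta.
have [alpha ealpha expa] := expansive.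
have [A [_ IA shA]] := shadow.
have separated x y : (forall t, alpha (rho t x, rho t y)) -> x = y.
  (* Expansivity is applied with the empty exceptional set, which lies in every ideal. *)
  move=> axy; apply: contrapT => /expa/(_ set0)[|t _ /(_ (axy t))//].
  by have [B IB] := ideal_nonempty I; exact: ideal_subset IB.
pose delta : set (X * X) := split_ent (split_ent alpha).
have edelta : entourage delta by do 2 apply: entourage_split_ent.
(* [theta] keeps [f] close to the identity; [delta], a quarter of [alpha], serves continuity and
   equivariance. *)
pose gamma := theta `&` (delta `&` delta^-1%relation).
have [|beta ebeta shbeta] := shA gamma.
  by apply: filterI => //; exact: entourage_invI.
have [U [oU Urho closeU]] := family_nbhs T I X rho A beta IA ebeta.
exists U; split=> // sigma [/closeU rho_sigma actsigma].
have [_ rho1 rhoM] := actrho; have [_ sigma1 sigmaM] := actsigma.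
have /choice[f trf] x : exists y, is_trace rho gamma (sigma ^~ x) y.
  (* Closeness of [rho a] and [sigma a] is used at the point [sigma t x]. *)
  by apply: shbeta => a t Aa /=; rewrite sigmaM; exact: rho_sigma.
have ga : gamma `<=` delta `&` delta^-1%relation by move=> p [].
have ga' : gamma `<=` split_ent alpha `&` (split_ent alpha)^-1%relation.
  have sdelta : delta `<=` split_ent alpha by exact: split_ent_subset.
  by move=> [u v] /ga [/sdelta uv /sdelta vu].
exists f; last first.
  (* The trace at time [1] compares [f x] with [x] itself. *)
  by move=> x /=; have [+ _] := trf x 1%g; rewrite rho1 sigma1.
split; last exact: (@tracing_map_equivariant _ _ _ _ alpha _ _ gamma).
by apply: (@tracing_map_continuous _ _ rho sigma alpha _ _ gamma) => // t;
  exact: Act_continuous.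
Qed.
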